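(* Let $\kappa,\beta>0$, let $V:\mathbb{R}^2\to\mathbb{R}$, $V=V(p,q)$, be smooth, and let $f:\mathbb{C}\to\mathbb{C}$ be given by $\mathrm{Re}\, f(p+iq)=\frac{\partial V}{\partial p}(p,q)$, $\mathrm{Im}\, f(p+iq)=\frac{\partial V}{\partial q}(p,q)$. Then the equation $$\kappa u_{tt}+iu_t+\beta u_{xx}+f(u)=0,\qquad u=u(x,t)\in\mathbb{C},$$ is multi-symplectic: writing $u=p+iq$, $p_x=v$, $q_x=w$, $p_t=\phi$, $q_t=\varphi$ and $z=(p,q,v,w,\phi,\varphi)^T\in\mathbb{R}^6$, it is equivalent (for smooth $u$) to the system $$\mathbb{K}z_t+\mathbb{M}z_x=\nabla_z\mathfrak{S}(z),\qquad \mathfrak{S}(z)=V(p,q)+\beta\,\frac{v^2+w^2}{2}+\kappa\,\frac{\phi^2+\varphi^2}{2},$$ with the real skew-symmetric matrices $$\mathbb{K}=\begin{pmatrix}0&1&0&0&-\kappa&0\\-1&0&0&0&0&-\kappa\\0&0&0&0&0&0\\0&0&0&0&0&0\\\kappa&0&0&0&0&0\\0&\kappa&0&0&0&0\end{pmatrix},\qquad\mathbb{M}=\begin{pmatrix}0&0&-\beta&0&0&0\\0&0&0&-\beta&0&0\\\beta&0&0&0&0&0\\0&\beta&0&0&0&0\\0&0&0&0&0&0\\0&0&0&0&0&0\end{pmatrix}.$$ Moreover, the multi-symplectic conservation law $$\partial_t\,\omega(U,W)+\partial_x\,k(U,W)=0$$ holds for any smooth solution $z$ of this system and any two smooth solutions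 $U,W$ of the associated variational equation $\mathbb{K}Z_t+\mathbb{M}Z_x=\mathfrak{S}''(z)Z$, where $$\omega=dp\wedge dq-\kappa(dp\wedge d\phi+dq\wedge d\varphi),\qquad k=-\beta(dp\wedge dv+dq\wedge dw).$$
   Context: $\nabla_z$ is the gradient in $\mathbb{R}^6$ and $\mathfrak{S}''(z)$ is the Hessian matrix of $\mathfrak{S}$ at $z$. For vectors $U,W\in\mathbb{R}^6$ with components indexed by $(p,q,v,w,\phi,\varphi)$, and coordinates $a,b$ among these, $(da\wedge db)(U,W)=U_aW_b-U_bW_a$. *)

(* Defs.v *)
From HB Require Import structures.
From mathcomp Require Import all_boot all_order all_algebra.
From mathcomp Require Import all_classical all_reals all_analysis.
From mathcomp Require Import complex.

Set Implicit Arguments.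
Unset Strict Implicit.
Unset Printing Implicit Defensive.

Import Order.TTheory GRing.Theory Num.Theory.
Import numFieldNormedType.Exports.

Local Open Scope classical_set_scope.
Local Open Scope ring_scope.

Section Smooth.
Context {R : realType} {E F : normedModType R}.

(* [f] is of class C^n on the open set [D].  In finite dimension, asking for
   continuous iterated derivatives in all directions is the same as asking for
   continuous iterated partial derivatives. *)
Fixpoint class_C (n : nat) (D : set E) (f : E -> F) : Prop :=
  (forall y, D y -> {for y, continuous f}) /\
  match n with
  | 0 => True
  | m.+1 => forall v : E,
      (forall y, D y -> derivable f y v) /\ class_C m D (fun y => 'D_v f y)
  end.

Definition smooth_on (D : set E) (f : E -> F) : Prop :=
  forall n, class_C n D f.

End Smooth.

(* A point of the plane is (x, t) for the unknowns and (p, q) for the potential. *)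
Section Plane.
Context {R : realType}.

Definition dir1 : R * R := (1, 0).
Definition dir2 : R * R := (0, 1).

Context {F : normedModType R}.

Definition partial1 (g : R * R -> F) (y : R * R) : F := 'D_dir1 g y.
Definition partial2 (g : R * R -> F) (y : R * R) : F := 'D_dir2 g y.

End Plane.

(* A complex-valued function of real variables is differentiated through its
   real and imaginary parts. *)
Section ComplexValued.
Context {R : realType}.

Definition re_part (u : R * R -> R[i]) (y : R * R) : R := complex.Re (u y).
Definition im_part (u : R * R -> R[i]) (y : R * R) : R := complex.Im (u y).

Definition csmooth_on (D : set (R * R)) (u : R * R -> R[i]) : Prop :=
  smooth_on D (re_part u) /\ smooth_on D (im_part u).

Definition cpartial1 (u : R * R -> R[i]) (y : R * R) : R[i] :=
  Complex (partial1 (re_part u) y) (partial1 (im_part u) y).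
Definition cpartial2 (u : R * R -> R[i]) (y : R * R) : R[i] :=
  Complex (partial2 (re_part u) y) (partial2 (im_part u) y).

Definition nls_wave_solution (kappa beta : R) (f : R[i] -> R[i])
    (D : set (R * R)) (u : R * R -> R[i]) : Prop :=
  forall y, D y ->
    (kappa%:C * cpartial2 (cpartial2 u) y + Complex 0 1 * cpartial2 u y
     + beta%:C * cpartial1 (cpartial1 u) y + f (u y))%C = 0.

End ComplexValued.

Section MultiSymplectic.
Context {R : realType} {n : nat}.

Definition basis_vec (i : 'I_n.+1) : 'cV[R]_n.+1 := delta_mx i 0.

Definition gradient (S : 'cV[R]_n.+1 -> R) (z : 'cV[R]_n.+1) : 'cV[R]_n.+1 :=
  \col_i 'D_(basis_vec i) S z.

Definition hessian (S : 'cV[R]_n.+1 -> R) (z : 'cV[R]_n.+1) : 'M[R]_n.+1 :=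
  \matrix_(i, j) 'D_(basis_vec i) (fun y => 'D_(basis_vec j) S y) z.

Definition skew_symmetric (A : 'M[R]_n.+1) : Prop := A^T = - A.

Definition hamiltonian_solution (K M : 'M[R]_n.+1) (S : 'cV[R]_n.+1 -> R)
    (D : set (R * R)) (z : R * R -> 'cV[R]_n.+1) : Prop :=
  forall y, D y ->
    K *m partial2 z y + M *m partial1 z y = gradient S (z y).

Definition variational_solution (K M : 'M[R]_n.+1) (S : 'cV[R]_n.+1 -> R)
    (D : set (R * R)) (z Z : R * R -> 'cV[R]_n.+1) : Prop :=
  forall y, D y ->
    K *m partial2 Z y + M *m partial1 Z y = hessian S (z y) *m Z y.

End MultiSymplectic.

Section SixVariables.
Context {R : realType}.

Definition ip : 'I_6 := @Ordinal 6 0 isT.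
Definition iq : 'I_6 := @Ordinal 6 1 isT.
Definition iv : 'I_6 := @Ordinal 6 2 isT.
Definition iw : 'I_6 := @Ordinal 6 3 isT.
Definition iphi : 'I_6 := @Ordinal 6 4 isT.
Definition ivarphi : 'I_6 := @Ordinal 6 5 isT.

Definition vec6 (p q v w phi varphi : R) : 'cV[R]_6 :=
  \col_i nth 0 [:: p; q; v; w; phi; varphi] i.

Definition mat6 (rows : seq (seq R)) : 'M[R]_6 :=
  \matrix_(i, j) nth 0 (nth [::] rows i) j.

Definition matK (kappa : R) : 'M[R]_6 := mat6
  [:: [::     0;     1; 0; 0; - kappa;       0];
      [::    -1;     0; 0; 0;       0; - kappa];
      [::     0;     0; 0; 0;       0;       0];
      [::     0;     0; 0; 0;       0;       0];
      [:: kappa;     0; 0; 0;       0;       0];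
      [::     0; kappa; 0; 0;       0;       0]].

Definition matM (beta : R) : 'M[R]_6 := mat6
  [:: [::    0;    0; - beta;      0; 0; 0];
      [::    0;    0;      0; - beta; 0; 0];
      [:: beta;    0;      0;      0; 0; 0];
      [::    0; beta;      0;      0; 0; 0];
      [::    0;    0;      0;      0; 0; 0];
      [::    0;    0;      0;      0; 0; 0]].

Definition hamiltonian (kappa beta : R) (V : R * R -> R) (z : 'cV[R]_6) : R :=
  V (z ip 0, z iq 0)
  + beta * ((z iv 0 ^+ 2 + z iw 0 ^+ 2) / 2)
  + kappa * ((z iphi 0 ^+ 2 + z ivarphi 0 ^+ 2) / 2).

(* z = (p, q, p_x, q_x, p_t, q_t) for u = p + iq *)
Definition state_of (u : R * R -> R[i]) (y : R * R) : 'cV[R]_6 :=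
  vec6 (re_part u y) (im_part u y)
       (partial1 (re_part u) y) (partial1 (im_part u) y)
       (partial2 (re_part u) y) (partial2 (im_part u) y).

Definition field_of (z : R * R -> 'cV[R]_6) (y : R * R) : R[i] :=
  Complex (z y ip 0) (z y iq 0).

Definition wedge (a b : 'I_6) (U W : 'cV[R]_6) : R :=
  U a 0 * W b 0 - U b 0 * W a 0.

Definition omega (kappa : R) (U W : 'cV[R]_6) : R :=
  wedge ip iq U W - kappa * (wedge ip iphi U W + wedge iq ivarphi U W).

Definition kform (beta : R) (U W : 'cV[R]_6) : R :=
  - beta * (wedge ip iv U W + wedge iq iw U W).

End SixVariables.

(* Main.v *)
Require Import Defs.
From mathcomp Require Import all_boot all_order all_algebra.
From mathcomp Require Import all_classical all_reals all_analysis.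
From mathcomp Require Import complex ring lra.

Import Order.TTheory GRing.Theory Num.Theory.
Import numFieldNormedType.Exports.

Local Open Scope classical_set_scope.
Local Open Scope ring_scope.

(** Written out in coordinates, [K z_t + M z_x = grad S] consists of four
    equations saying that [v, w, phi, varphi] are the first derivatives of [p]
    and [q], because [kappa] and [beta] are invertible, and of two equations
    which, after these substitutions, are minus the real and imaginary parts of
    the wave equation ([hamiltonian_systemP], [nls_wave_equationP]).  This gives
    both equivalences; on an open set, replacing [z] by the state vector of
    [p + iq] changes none of the derivatives involved.

    For the conservation law, the two forms are bilinear: [omega (U, W)] is
    [U^T K W] and [k (U, W)] is [U^T M W].  By the product rule and the skew
    symmetry of [K] and [M], the divergence
    [d_t (U^T K W) + d_x (U^T M W)] equals
    [- (K U_t + M U_x)^T W + U^T (K W_t + M W_x)], that is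
    [- (H U)^T W + U^T H W] with [H] the Hessian of [S], by the variational
    equation.  It vanishes because [H] is symmetric
    ([multisymplectic_conservation]).  The quadratic part of [S] has a
    symmetric Hessian by inspection; for [V] this is the symmetry of mixed
    second derivatives, proved here from the mean value theorem
    ([schwarz]). *)

(** * Directional derivatives and the symmetry of mixed derivatives *)

Section DirectionalDerivatives.
Context {R : realType}.

(** The two difference quotients are the same function of the increment, so
    this holds whether or not the derivative exists. *)
Lemma derive_comp_affine {E E' F : normedModType R} (f : E -> F) (g : E' -> E)
    (x v : E') (w : E) :
  (forall h : R, g (h *: v + x) = h *: w + g x) ->
  'D_v (f \o g) x = 'D_w f (g x).
Proof.
by move=> gE; rewrite /derive; under eq_fun do rewrite /= gE.
Qed.

Lemma is_derive_comp_affine {E E' F : normedModType R} (f : E -> F)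
    (g : E' -> E) (x v : E') (w : E) (df : F) :
  (forall h : R, g (h *: v + x) = h *: w + g x) ->
  is_derive (g x) w f df -> is_derive x v (f \o g) df.
Proof.
move=> gE [dr <-]; split; last exact: derive_comp_affine.
by rewrite /derivable; under eq_fun do rewrite /= gE.
Qed.

Lemma directional_MVT {E : normedModType R} (f : E -> R) (x v : E) (h : R) :
  0 < h -> (forall y, derivable f y v) ->
  exists2 s, 0 < s < h & f (h *: v + x) - f x = h * 'D_v f (s *: v + x).
Proof.
move=> h0 df; pose g (s : R) := s *: v + x.
have dfg (s : R) : is_derive s 1 (f \o g) ('D_v f (g s)).
  apply: (@is_derive_comp_affine _ _ _ _ g _ _ v); last exact/derivableP.
  by move=> k; rewrite /g scalerDl /GRing.scale/= mulr1 addrA.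
have [|s sh] := @MVT R (f \o g) (fun s => 'D_v f (g s)) 0 h h0 (fun s _ => dfg s).
  by apply: derivable_within_continuous => s _; have [] := dfg s.
rewrite /g/= scale0r add0r subr0 => ->; exists s; last by rewrite mulrC.
by move: sh; rewrite in_itv.
Qed.

(** The mean value theorem in the direction [a], applied to the difference of
    [f] across [h *: b], turns the second difference into
    [h] times a difference of ['D_a f] across [h *: b]; the mean value theorem
    in the direction [b] evaluates the latter. *)
Lemma second_difference {E : normedModType R} (f : E -> R) (x a b : E) (h : R) :
  0 < h -> (forall y, derivable f y a) ->
  (forall y, derivable (fun y => 'D_a f y) y b) ->
  exists s t, [/\ 0 < s < h, 0 < t < h &
    f (h *: a + (h *: b + x)) - f (h *: b + x) - (f (h *: a + x) - f x)
    = h * (h * 'D_b (fun y => 'D_a f y) (t *: b + (s *: a + x)))].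
Proof.
move=> h0 fa fab; pose g y := f (h *: b + y) - f y.
have dg y : is_derive y a g ('D_a f (h *: b + y) - 'D_a f y).
  apply: is_deriveB; last exact/derivableP.
  apply: (@is_derive_comp_affine _ _ _ _ (fun y => h *: b + y) _ _ a).
    by move=> k; rewrite addrCA.
  exact/derivableP.
have [|s sh gE] := @directional_MVT _ g x a h h0; first by move=> y; have [] := dg y.
have [t th fE] := @directional_MVT _ (fun y => 'D_a f y) (s *: a + x) b h h0 fab.
exists s, t; split => //; move: gE.
rewrite (@derive_val _ _ _ _ _ _ _ (dg _)) fE => <-.
by rewrite /g [h *: a + (h *: b + x)]addrCA; ring.
Qed.

(** Continuity lets one compare two functions at [x] through values taken at
    two different points close to [x]. *)
Lemma eq_of_nearby_values {E : normedModType R} (g1 g2 : E -> R) (x : E) :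
  {for x, continuous g1} -> {for x, continuous g2} ->
  (forall d, 0 < d ->
    exists y1 y2, [/\ `|x - y1| < d, `|x - y2| < d & g1 y1 = g2 y2]) ->
  g1 x = g2 x.
Proof.
move=> c1 c2 g12; apply/eqP; rewrite -subr_eq0 -normr_le0.
apply/ler_addgt0Pr => e e0; rewrite add0r.
have e20 : 0 < e / 2 by rewrite divr_gt0.
have /nbhs_normP[d /= d0 dP] : \forall y \near x,
    `|g1 x - g1 y| <= e / 2 /\ `|g2 x - g2 y| <= e / 2.
  by apply: filterI; [move/cvgrPdist_le: c1 | move/cvgrPdist_le: c2]; apply.
have [y1 [y2 [/dP[+ _] /dP[_ +] g1y1]]] := g12 d d0; rewrite g1y1 => H1 H2.
rewrite -(subrKA (g2 y2)) (le_trans (ler_normD _ _))//.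
by rewrite [leRHS]splitr lerD// distrC.
Qed.

(** The second difference of [f] along [a] and [b] is symmetric in [a] and
    [b], so expanding it in both orders by [second_difference] makes the two
    mixed derivatives agree at points as close to [x] as desired. *)
Lemma schwarz {E : normedModType R} (f : E -> R) (x a b : E) :
  (forall y, derivable f y a) -> (forall y, derivable f y b) ->
  (forall y, derivable (fun y => 'D_a f y) y b) ->
  (forall y, derivable (fun y => 'D_b f y) y a) ->
  {for x, continuous (fun y => 'D_b (fun y => 'D_a f y) y)} ->
  {for x, continuous (fun y => 'D_a (fun y => 'D_b f y) y)} ->
  'D_a (fun y => 'D_b f y) x = 'D_b (fun y => 'D_a f y) x.
Proof.
move=> fa fb fab fba cab cba.
apply: (eq_of_nearby_values _ _ _ cba cab) => d d0.
(* [h * (`|a| + `|b|) < d] keeps the parallelogram of sides [h *: a] and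
   [h *: b] at [x] within distance [d] of [x]; adding 1 makes the denominator positive. *)
pose h := d / (`|a| + `|b| + 1).
have n0 : 0 < `|a| + `|b| + 1 by rewrite ltr_wpDl// addr_ge0.
have h0 : 0 < h by rewrite divr_gt0.
have small s t : 0 < s < h -> 0 < t < h -> `|x - (s *: a + (t *: b + x))| < d.
  move=> /andP[s0 sh] /andP[t0 th].
  rewrite addrA distrC addrK (le_lt_trans (ler_normD _ _))// !normrZ !gtr0_norm//.
  rewrite (@le_lt_trans _ _ (h * `|a| + h * `|b|))//.
    by rewrite lerD// ler_wpM2r// ltW.
  by rewrite -mulrDr /h mulrAC ltr_pdivrMr// ltr_pM2l// ltrDl.
have [s [t [sh th ab]]] := second_difference f x a b h h0 fa fab.
have [t' [s' [th' sh' ba]]] := second_difference f x b a h h0 fb fba.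
exists (s' *: a + (t' *: b + x)), (s *: a + (t *: b + x)).
split; [exact: small | exact: small |].
apply: (mulfI (lt0r_neq0 h0)); apply: (mulfI (lt0r_neq0 h0)).
rewrite -ba (addrCA (s *: a) (t *: b) x) -ab (addrCA (h *: b) (h *: a) x).
ring.
Qed.

End DirectionalDerivatives.

(** * Smooth functions *)

Section SmoothFunctions.
Context {R : realType}.

(** Iterated derivatives on an open set only see the values on that set. *)
Lemma class_C_near_eq {E F : normedModType R} (n : nat) (D : set E)
    (f g : E -> F) :
  open D -> (forall y, D y -> f y = g y) -> class_C n D f -> class_C n D g.
Proof.
move=> Do; elim: n f g => [|n IH] f g fg /= [cf Hf].
all: have nfg y : D y -> \near y, f y = g y by
  move=> Dy; apply: filterS (open_nbhs_nbhs (conj Do Dy)).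
all: split; first by
  move=> y Dy; rewrite /prop_for /continuous_at -fg//;
  apply: cvg_trans (cf y Dy); apply: near_eq_cvg; exact: nfg.
- by [].
- move=> v; have [df Cf] := Hf v; split.
    by move=> y Dy; exact: near_eq_derivable (nfg y Dy) (df y Dy).
  by apply: IH Cf => y Dy; exact/near_eq_derive/nfg.
Qed.

(** Taking a coordinate commutes with differentiation only where the derivative
    exists, hence the passage through [class_C_near_eq] on the open set [D]. *)
Lemma smooth_on_coord {E : normedModType R} {m n : nat} (D : set E)
    (z : E -> 'M[R]_(m, n)) (i : 'I_m) (j : 'I_n) :
  open D -> smooth_on D z -> smooth_on D (fun y => z y i j).
Proof.
move=> Do zs k; elim: k z {zs}(zs k) => [|k IH] z /= [cz Hz].
all: split; first by
  move=> y Dy; apply: (@continuous_comp _ _ _ z (fun A : 'M[R]_(m, n) => A i j));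
  [exact: cz | exact: coord_continuous].
- by [].
- move=> v; have [dz Cz] := Hz v; split.
    by move=> y Dy; have /derivable_mxP := dz y Dy; exact.
  apply: class_C_near_eq Do _ (IH _ Cz) => y Dy.
  by rewrite derive_mx ?mxE //; exact: dz.
Qed.

Lemma smooth_derivable {E F : normedModType R} (D : set E) (f : E -> F) (y v : E) :
  smooth_on D f -> D y -> derivable f y v.
Proof. by move=> /(_ 1%N)[_ /(_ v)[+ _]]; exact. Qed.

Lemma smooth_derive {E F : normedModType R} (D : set E) (f : E -> F) (v : E) :
  smooth_on D f -> smooth_on D (fun y => 'D_v f y).
Proof. by move=> fs n; have [_ /(_ v)[]] := fs n.+1. Qed.

Lemma smooth_continuous {E F : normedModType R} (D : set E) (f : E -> F) (y : E) :
  smooth_on D f -> D y -> {for y, continuous f}.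
Proof. by move=> /(_ 0)[+ _]; exact. Qed.

Lemma smooth_schwarz {E : normedModType R} (f : E -> R) (x a b : E) :
  smooth_on setT f ->
  'D_a (fun y => 'D_b f y) x = 'D_b (fun y => 'D_a f y) x.
Proof.
move=> fs; apply: schwarz => [y|y|y|y||].
1,2: exact: smooth_derivable fs _.
1,2: by apply: smooth_derivable (smooth_derive _ _ _ fs) _.
all: by apply: (@smooth_continuous _ _ setT); first
  exact: smooth_derive (smooth_derive _ _ _ fs).
Qed.

End SmoothFunctions.

(** * Derivatives of bilinear forms and the conservation law *)

Section MatrixValued.
Context {R : realType} {E : normedModType R}.

Lemma derive_coord {m n : nat} (z : E -> 'M[R]_(m, n)) (y v : E) i j :
  derivable z y v -> ('D_v z y) i j = 'D_v (fun y => z y i j) y.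
Proof. by move=> dz; rewrite derive_mx// mxE. Qed.

Lemma is_derive_coord {m n : nat} (z : E -> 'M[R]_(m, n)) (y v : E) i j :
  derivable z y v -> is_derive y v (fun y => z y i j) (('D_v z y) i j).
Proof.
move=> dz; split; last by rewrite derive_coord.
by have /derivable_mxP := dz; exact.
Qed.

Lemma mx_form_sum {n : nat} (A : 'M[R]_n) (U W : 'cV[R]_n) :
  (U^T *m A *m W) 0 0 = \sum_i \sum_j A i j * (U i 0 * W j 0).
Proof.
rewrite mxE exchange_big; apply: eq_bigr => j _; rewrite mxE mulr_suml.
by apply: eq_bigr => i _; rewrite mxE mulrCA mulrA.
Qed.

Lemma derive_mx_form {n : nat} (A : 'M[R]_n) (U W : E -> 'cV[R]_n) (y v : E) :
  derivable U y v -> derivable W y v ->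
  'D_v (fun y => ((U y)^T *m A *m W y) 0 0) y
  = (('D_v U y)^T *m A *m W y) 0 0 + ((U y)^T *m A *m 'D_v W y) 0 0.
Proof.
move=> dU dW.
pose h i j := A i j \*: ((fun y => U y i 0) * (fun y => W y j 0)).
have -> : (fun y => ((U y)^T *m A *m W y) 0 0) = \sum_i \sum_j h i j.
  apply/funext => x; rewrite mx_form_sum fct_sumE; apply: eq_bigr => i _.
  by rewrite fct_sumE; apply: eq_bigr.
have dh i j := is_deriveZ (A i j)
  (is_deriveM (is_derive_coord _ _ _ i 0 dU) (is_derive_coord _ _ _ j 0 dW)).
rewrite (@derive_val _ _ _ _ _ _ _
  (is_derive_sum (fun i => is_derive_sum (fun j => dh i j)))).
rewrite !mx_form_sum -big_split; apply: eq_bigr => i _.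
rewrite -big_split; apply: eq_bigr => j _.
by rewrite /= /GRing.scale /=; ring.
Qed.

End MatrixValued.

Section ConservationLaw.
Context {R : realType} {n : nat}.

(** Moving [K] and [M] onto the left factor costs a sign, so the four terms
    regroup as [- (H u)^T w + u^T (H w)]. *)
Lemma skew_pairing_cancel (K M H : 'M[R]_n) (u ut ux w wt wx : 'cV[R]_n) :
  K^T = - K -> M^T = - M -> H^T = H ->
  K *m ut + M *m ux = H *m u -> K *m wt + M *m wx = H *m w ->
  (ut^T *m K *m w + u^T *m K *m wt) + (ux^T *m M *m w + u^T *m M *m wx) = 0.
Proof.
move=> KT MT HT Hu Hw; rewrite addrACA -!(mulmxA u^T) -mulmxDr Hw -mulmxDl.
have -> : ut^T *m K + ux^T *m M = - (u^T *m H).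
  by rewrite -[in RHS]HT -trmx_mul -Hu linearD/= !trmx_mul KT MT !mulmxN -opprD opprK.
by rewrite mulNmx -mulmxA addNr.
Qed.

Lemma multisymplectic_conservation (K M H : 'M[R]_n) (U W : R * R -> 'cV[R]_n)
    (y : R * R) :
  K^T = - K -> M^T = - M -> H^T = H ->
  (forall v, derivable U y v) -> (forall v, derivable W y v) ->
  K *m partial2 U y + M *m partial1 U y = H *m U y ->
  K *m partial2 W y + M *m partial1 W y = H *m W y ->
  partial2 (fun y => ((U y)^T *m K *m W y) 0 0) y
  + partial1 (fun y => ((U y)^T *m M *m W y) 0 0) y = 0.
Proof.
move=> KT MT HT dU dW HU HW; rewrite /partial1 /partial2 !derive_mx_form//.
have addE (A B : 'M[R]_1) : A 0 0 + B 0 0 = (A + B) 0 0 by rewrite mxE.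
by rewrite !addE (skew_pairing_cancel K M H)// mxE.
Qed.

End ConservationLaw.

(** * The six coordinates *)

Section SixCoordinates.
Context {R : realType}.

Lemma I6_ind (P : 'I_6 -> Prop) :
  P ip -> P iq -> P iv -> P iw -> P iphi -> P ivarphi -> forall i, P i.
Proof.
move=> h0 h1 h2 h3 h4 h5 i.
suff : i \in [:: ip; iq; iv; iw; iphi; ivarphi].
  by rewrite !inE => /or4P[|||/or3P[||]] /eqP ->.
by rewrite !inE -!val_eqE; case: i => [[|[|[|[|[|[|]]]]]]].
Qed.

Lemma sum_I6 (F : 'I_6 -> R) :
  \sum_i F i = F ip + F iq + F iv + F iw + F iphi + F ivarphi.
Proof.
rewrite !big_ord_recl big_ord0 addr0 !addrA.
by do !congr (_ + _); congr F; exact/val_inj.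
Qed.

Lemma eq_vec6 (p q v w phi varphi p' q' v' w' phi' varphi' : R) :
  vec6 p q v w phi varphi = vec6 p' q' v' w' phi' varphi' ->
  [/\ p = p', q = q' & v = v'] /\ [/\ w = w', phi = phi' & varphi = varphi'].
Proof.
move=> /matrixP e.
by split; split; [have := e ip 0 | have := e iq 0 | have := e iv 0
  | have := e iw 0 | have := e iphi 0 | have := e ivarphi 0]; rewrite !mxE.
Qed.

Lemma mulmx_matKM (kappa beta : R) (a b : 'cV[R]_6) :
  matK kappa *m a + matM beta *m b =
  vec6 (a iq 0 - kappa * a iphi 0 - beta * b iv 0)
       (- a ip 0 - kappa * a ivarphi 0 - beta * b iw 0)
       (beta * b ip 0) (beta * b iq 0)
       (kappa * a ip 0) (kappa * a iq 0).
Proof.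
apply/matrixP => i j; rewrite ord1 mxE [in LHS]mxE [X in _ + X]mxE !sum_I6.
by elim/I6_ind: i; rewrite !mxE /=; ring.
Qed.

Lemma omegaE (kappa : R) (U W : 'cV[R]_6) :
  omega kappa U W = (U^T *m matK kappa *m W) 0 0.
Proof.
by rewrite mx_form_sum sum_I6 !sum_I6 /omega /wedge !mxE /=; ring.
Qed.

Lemma kformE (beta : R) (U W : 'cV[R]_6) :
  kform beta U W = (U^T *m matM beta *m W) 0 0.
Proof.
by rewrite mx_form_sum sum_I6 !sum_I6 /kform /wedge !mxE /=; ring.
Qed.

Lemma matK_skew (kappa : R) : skew_symmetric (matK kappa).
Proof.
apply/matrixP => i j; rewrite !mxE.
by elim/I6_ind: i; elim/I6_ind: j; rewrite /= ?oppr0 ?opprK.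
Qed.

Lemma matM_skew (beta : R) : skew_symmetric (matM beta).
Proof.
apply/matrixP => i j; rewrite !mxE.
by elim/I6_ind: i; elim/I6_ind: j; rewrite /= ?oppr0 ?opprK.
Qed.

End SixCoordinates.

(** * Gradient and Hessian of the Hamiltonian *)

Section HamiltonianDerivatives.
Context {R : realType} (kappa beta : R) (V : R * R -> R).

(** A linear projection, so that [V \o pq] is differentiated by
    [derive_comp_affine]. *)
Definition pq (z : 'cV[R]_6) : R * R := (z ip 0, z iq 0).

Lemma pq_line (z a : 'cV[R]_6) (h : R) : pq (h *: a + z) = h *: pq a + pq z.
Proof. by rewrite /pq !mxE. Qed.

Lemma pq_basis_vec (i : 'I_6) : pq (basis_vec i) = nth 0 [:: dir1; dir2] i.
Proof. by elim/I6_ind: i; rewrite /pq !mxE. Qed.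

Let coord (i : 'I_6) (z : 'cV[R]_6) : R := z i 0.

Lemma is_derive_coord_id (z a : 'cV[R]_6) (i : 'I_6) :
  is_derive z a (coord i) (a i 0).
Proof.
have := is_derive_coord (@idfun 'cV[R]_6) z a i 0 (@derivable_id _ _ z a).
by rewrite derive_id.
Qed.

Let quadratic (z a : 'cV[R]_6) : R :=
  beta * (z iv 0 * a iv 0 + z iw 0 * a iw 0)
  + kappa * (z iphi 0 * a iphi 0 + z ivarphi 0 * a ivarphi 0).

(** In the direction [a], [V \o pq] varies like [V] in the direction [pq a],
    and the remaining part of the Hamiltonian has polar form [quadratic]. *)
Lemma derive_hamiltonian (z a : 'cV[R]_6) :
  derivable V (pq z) (pq a) ->
  'D_a (hamiltonian kappa beta V) z = 'D_(pq a) V (pq z) + quadratic z a.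
Proof.
move=> dV.
have -> : hamiltonian kappa beta V = (V \o pq)
    + ((beta / 2) \*: (coord iv ^+ 2 + coord iw ^+ 2)
       + (kappa / 2) \*: (coord iphi ^+ 2 + coord ivarphi ^+ 2)).
  apply/funext => y; rewrite /hamiltonian !fctE /= /GRing.scale /=.
  by rewrite /pq /coord; ring.
have dVpq : is_derive z a (V \o pq) ('D_(pq a) V (pq z)).
  apply: is_derive_comp_affine; first by move=> h; exact: pq_line.
  exact/derivableP.
have sq i k j := is_deriveZ k (is_deriveD
  (is_deriveX 2 (is_derive_coord_id z a i)) (is_deriveX 2 (is_derive_coord_id z a j))).
rewrite (@derive_val _ _ _ _ _ _ _
  (is_deriveD dVpq (is_deriveD (sq iv (beta / 2) iw) (sq iphi (kappa / 2) ivarphi)))).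
rewrite /quadratic /coord /GRing.scale /= !expr1.
by congr (_ + _); field.
Qed.

Lemma second_derive_hamiltonian (z a b : 'cV[R]_6) :
  smooth_on setT V ->
  'D_a (fun y => 'D_b (hamiltonian kappa beta V) y) z
  = 'D_(pq a) (fun y => 'D_(pq b) V y) (pq z) + quadratic a b.
Proof.
move=> Vs.
have -> : (fun y => 'D_b (hamiltonian kappa beta V) y) =
    ((fun y => 'D_(pq b) V y) \o pq)
    + (((beta * b iv 0) \*: coord iv + (beta * b iw 0) \*: coord iw)
    + ((kappa * b iphi 0) \*: coord iphi
       + (kappa * b ivarphi 0) \*: coord ivarphi)).
  apply/funext => y; rewrite derive_hamiltonian; last exact: smooth_derivable Vs _.
  by rewrite !fctE /= /GRing.scale /= /quadratic /coord; congr (_ + _); ring.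
have dVpq : is_derive z a ((fun y => 'D_(pq b) V y) \o pq)
    ('D_(pq a) (fun y => 'D_(pq b) V y) (pq z)).
  apply: is_derive_comp_affine; first by move=> h; exact: pq_line.
  by apply/derivableP; apply: smooth_derivable (smooth_derive _ _ _ Vs) _.
have lin i k := is_deriveZ k (is_derive_coord_id z a i).
rewrite (@derive_val _ _ _ _ _ _ _ (is_deriveD dVpq (is_deriveD
  (is_deriveD (lin iv (beta * b iv 0)) (lin iw (beta * b iw 0)))
  (is_deriveD (lin iphi (kappa * b iphi 0)) (lin ivarphi (kappa * b ivarphi 0)))))).
by rewrite /quadratic /GRing.scale /=; congr (_ + _); ring.
Qed.

(** For [V] this is the symmetry of mixed second derivatives; [quadratic] is
    symmetric in its two arguments. *)
Lemma hessian_hamiltonian_sym (z : 'cV[R]_6) :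
  smooth_on setT V ->
  (hessian (hamiltonian kappa beta V) z)^T = hessian (hamiltonian kappa beta V) z.
Proof.
move=> Vs; apply/matrixP => i j; rewrite !mxE !second_derive_hamiltonian//.
by rewrite (smooth_schwarz V)// /quadratic; congr (_ + _); ring.
Qed.

Lemma gradient_hamiltonian (z : 'cV[R]_6) :
  smooth_on setT V ->
  gradient (hamiltonian kappa beta V) z =
  vec6 (partial1 V (z ip 0, z iq 0)) (partial2 V (z ip 0, z iq 0))
       (beta * z iv 0) (beta * z iw 0) (kappa * z iphi 0) (kappa * z ivarphi 0).
Proof.
move=> Vs; apply/matrixP => i j; rewrite ord1 !mxE derive_hamiltonian; last first.
  exact: smooth_derivable Vs _.
rewrite pq_basis_vec.
by elim/I6_ind: i; rewrite /quadratic !mxE /= ?derive0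
  ?(mulr0, mulr1, add0r, addr0).
Qed.

End HamiltonianDerivatives.

(** * The wave equation in first-order form *)

Section WaveEquation.
Context {R : realType} (kappa beta : R) (V : R * R -> R).
Context (kappa_neq0 : kappa != 0) (beta_neq0 : beta != 0).
Context (V_smooth : smooth_on setT V).

Local Notation K := (matK kappa).
Local Notation M := (matM beta).
Local Notation S := (hamiltonian kappa beta V).

(** The last four rows carry a factor [beta] or [kappa] on both sides;
    cancelling it leaves the definitions of [v, w, phi, varphi] as derivatives
    of [p] and [q]. *)
Lemma hamiltonian_systemP (zt zx z : 'cV[R]_6) :
  K *m zt + M *m zx = gradient S z <->
  [/\ zx ip 0 = z iv 0, zx iq 0 = z iw 0, zt ip 0 = z iphi 0
    & zt iq 0 = z ivarphi 0] /\
  [/\ zt iq 0 - kappa * zt iphi 0 - beta * zx iv 0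
      = partial1 V (z ip 0, z iq 0)
    & - zt ip 0 - kappa * zt ivarphi 0 - beta * zx iw 0
      = partial2 V (z ip 0, z iq 0)].
Proof.
rewrite mulmx_matKM gradient_hamiltonian//; split.
  move=> /eq_vec6[[e1 e2 /(mulfI beta_neq0)e3]].
  by move=> [/(mulfI beta_neq0)e4 /(mulfI kappa_neq0)e5 /(mulfI kappa_neq0)e6].
by move=> [[-> -> -> ->] [-> ->]].
Qed.

(** The form that applies to a state vector, whose derivatives are explicit
    vectors by [derive_state_of]. *)
Lemma hamiltonian_system_vec6 (pt qt vt wt phit varphit px qx vx wx phix varphix
    p q v w phi varphi : R) :
  K *m vec6 pt qt vt wt phit varphit + M *m vec6 px qx vx wx phix varphix
  = gradient S (vec6 p q v w phi varphi) <->
  [/\ px = v, qx = w, pt = phi & qt = varphi] /\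
  (qt - kappa * phit - beta * vx = partial1 V (p, q) /\
   - pt - kappa * varphit - beta * wx = partial2 V (p, q)).
Proof.
by apply: (iff_trans (hamiltonian_systemP _ _ _)); rewrite !mxE /=;
  split=> [[? [? ?]]|[? [? ?]]].
Qed.

(** The indices 1, 2, 3 stand for the derivatives [u_t], [u_tt], [u_xx]; both
    parts are negated to match the first two rows of the Hamiltonian system. *)
Lemma nls_wave_partsP (a1 b1 a2 b2 a3 b3 a b : R) :
  (kappa%:C * Complex a2 b2 + Complex 0 1 * Complex a1 b1
     + beta%:C * Complex a3 b3 + Complex a b)%C = 0 <->
  b1 - kappa * a2 - beta * a3 = a /\ - a1 - kappa * b2 - beta * b3 = b.
Proof.
set l := (X in X = 0 <-> _).
have -> : l = Complex (kappa * a2 - b1 + beta * a3 + a)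
                      (kappa * b2 + a1 + beta * b3 + b).
  by apply/eqP; rewrite eq_complex /=; apply/andP; split; apply/eqP; ring.
split=> [[e1 e2]|[e1 e2]]; first by split; lra.
by congr Complex; lra.
Qed.

Lemma nls_wave_equationP (f : R[i] -> R[i]) (u : R * R -> R[i]) (y : R * R) :
  (forall p q : R, complex.Re (f (Complex p q)) = partial1 V (p, q)) ->
  (forall p q : R, complex.Im (f (Complex p q)) = partial2 V (p, q)) ->
  (kappa%:C * cpartial2 (cpartial2 u) y + Complex 0 1 * cpartial2 u y
     + beta%:C * cpartial1 (cpartial1 u) y + f (u y))%C = 0 <->
  partial2 (im_part u) y - kappa * partial2 (partial2 (re_part u)) y
    - beta * partial1 (partial1 (re_part u)) y
    = partial1 V (re_part u y, im_part u y) /\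
  - partial2 (re_part u) y - kappa * partial2 (partial2 (im_part u)) y
    - beta * partial1 (partial1 (im_part u)) y
    = partial2 V (re_part u y, im_part u y).
Proof.
move=> Ref Imf; rewrite -Ref -Imf.
have -> : Complex (re_part u y) (im_part u y) = u y.
  by rewrite /re_part /im_part; case: (u y).
case: (f (u y)) => a b.
exact: nls_wave_partsP.
Qed.

Lemma derivable_state_of (D : set (R * R)) (u : R * R -> R[i]) (y v : R * R) :
  csmooth_on D u -> D y -> derivable (state_of u) y v.
Proof.
move=> [us1 us2] Dy; apply/derivable_mxP => i j.
have dE k : forall g : R * R -> R, (forall x, state_of u x k j = g x) ->
    smooth_on D g -> derivable (fun x => state_of u x k j) y v.
  by move=> g gE gs; rewrite (funext gE); exact: smooth_derivable gs Dy.
by elim/I6_ind: i; apply: dE => [x|]; rewrite ?mxE//=;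
  exact: smooth_derive.
Qed.

End WaveEquation.

Section Equivalence.
Context {R : realType} (kappa beta : R) (V : R * R -> R).
Context (kappa_neq0 : kappa != 0) (beta_neq0 : beta != 0).
Context (V_smooth : smooth_on setT V).
Context (f : R[i] -> R[i]).
Context (Re_f : forall p q : R, complex.Re (f (Complex p q)) = partial1 V (p, q)).
Context (Im_f : forall p q : R, complex.Im (f (Complex p q)) = partial2 V (p, q)).

Local Notation K := (matK kappa).
Local Notation M := (matM beta).
Local Notation S := (hamiltonian kappa beta V).

Lemma derive_state_of (D : set (R * R)) (u : R * R -> R[i]) (y v : R * R) :
  csmooth_on D u -> D y ->
  'D_v (state_of u) y =
  vec6 ('D_v (re_part u) y) ('D_v (im_part u) y)
       ('D_v (partial1 (re_part u)) y) ('D_v (partial1 (im_part u)) y)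
       ('D_v (partial2 (re_part u)) y) ('D_v (partial2 (im_part u)) y).
Proof.
move=> us Dy; apply/matrixP => i j; rewrite ord1 mxE.
rewrite derive_coord; last exact: derivable_state_of us Dy.
by elim/I6_ind: i; congr ('D_v _ y); apply/funext => x; rewrite mxE.
Qed.

Lemma nls_wave_state_of (D : set (R * R)) (u : R * R -> R[i]) :
  csmooth_on D u ->
  nls_wave_solution kappa beta f D u <->
  hamiltonian_solution K M S D (state_of u).
Proof.
move=> us.
suff e y : D y ->
    (kappa%:C * cpartial2 (cpartial2 u) y + Complex 0 1 * cpartial2 u y
     + beta%:C * cpartial1 (cpartial1 u) y + f (u y))%C = 0 <->
    K *m partial2 (state_of u) y + M *m partial1 (state_of u) y
    = gradient S (state_of u y).
  by split=> sol y Dy; apply/(e y Dy)/(sol y Dy).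
move=> Dy; apply: (iff_trans (nls_wave_equationP _ _ V f u y Re_f Im_f)).
have -> : partial1 (state_of u) y = _ := derive_state_of D u y dir1 us Dy.
have -> : partial2 (state_of u) y = _ := derive_state_of D u y dir2 us Dy.
apply: iff_trans (iff_sym (hamiltonian_system_vec6 _ _ _ kappa_neq0 beta_neq0
  V_smooth _ _ _ _ _ _ _ _ _ _ _ _ _ _ _ _ _ _)).
by split=> [|[_]].
Qed.

Lemma hamiltonian_solution_near_eq (D : set (R * R)) (z z' : R * R -> 'cV[R]_6) :
  open D -> (forall y, D y -> z y = z' y) ->
  hamiltonian_solution K M S D z -> hamiltonian_solution K M S D z'.
Proof.
move=> Do zz' sol y Dy; have nzz' : \near y, z y = z' y.
  exact: filterS (open_nbhs_nbhs (conj Do Dy)).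
by rewrite -zz'// -sol// /partial1 /partial2 !(near_eq_derive _ nzz').
Qed.

Lemma csmooth_field_of (D : set (R * R)) (z : R * R -> 'cV[R]_6) :
  open D -> smooth_on D z -> csmooth_on D (field_of z).
Proof.
by move=> Do zs; split; [exact: (smooth_on_coord _ _ ip 0 Do zs)
  | exact: (smooth_on_coord _ _ iq 0 Do zs)].
Qed.

(** A solution is determined by its first two coordinates, because four of the
    six equations give the others as their derivatives. *)
Lemma hamiltonian_solution_state_of (D : set (R * R)) (z : R * R -> 'cV[R]_6) :
  smooth_on D z -> hamiltonian_solution K M S D z ->
  forall y, D y -> z y = state_of (field_of z) y.
Proof.
move=> zs sol y Dy.
have [[vE wE phiE varphiE] _] := (hamiltonian_systemP _ _ _ kappa_neq0
  beta_neq0 V_smooth _ _ _).1 (sol y Dy).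
have dE v i := derive_coord z y v i 0 (smooth_derivable D z y v zs Dy).
apply/matrixP => i j; rewrite ord1 mxE.
elim/I6_ind: i.
- by [].
- by [].
- exact: etrans (esym vE) (dE dir1 ip).
- exact: etrans (esym wE) (dE dir1 iq).
- exact: etrans (esym phiE) (dE dir2 ip).
- exact: etrans (esym varphiE) (dE dir2 iq).
Qed.

End Equivalence.

Theorem mainTheorem5 (R : realType) (kappa beta : R)
    (kappa_gt0 : 0 < kappa) (beta_gt0 : 0 < beta)
    (V : R * R -> R) (V_smooth : smooth_on setT V)
    (f : R[i] -> R[i])
    (Re_f : forall p q : R, complex.Re (f (Complex p q)) = partial1 V (p, q))
    (Im_f : forall p q : R, complex.Im (f (Complex p q)) = partial2 V (p, q))
    (D : set (R * R)) (D_open : open D) :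
  [/\ skew_symmetric (matK kappa) /\ skew_symmetric (matM beta),
      forall u : R * R -> R[i], csmooth_on D u ->
        nls_wave_solution kappa beta f D u <->
        hamiltonian_solution (matK kappa) (matM beta)
          (hamiltonian kappa beta V) D (state_of u),
      forall z : R * R -> 'cV[R]_6, smooth_on D z ->
        hamiltonian_solution (matK kappa) (matM beta)
          (hamiltonian kappa beta V) D z <->
        (forall y, D y -> z y = state_of (field_of z) y) /\
        nls_wave_solution kappa beta f D (field_of z)
    & forall z U W : R * R -> 'cV[R]_6,
        smooth_on D z -> smooth_on D U -> smooth_on D W ->
        hamiltonian_solution (matK kappa) (matM beta)
          (hamiltonian kappa beta V) D z ->
        variational_solution (matK kappa) (matM beta)
          (hamiltonian kappa beta V) D z U ->
        variational_solution (matK kappa) (matM beta)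
          (hamiltonian kappa beta V) D z W ->
        forall y, D y ->
          partial2 (fun y' => omega kappa (U y') (W y')) y
          + partial1 (fun y' => kform beta (U y') (W y')) y = 0].
Proof.
have kappa_neq0 := lt0r_neq0 kappa_gt0; have beta_neq0 := lt0r_neq0 beta_gt0.
have nlsP := nls_wave_state_of kappa beta V kappa_neq0 beta_neq0 V_smooth f
  Re_f Im_f D.
split; [by split; [exact: matK_skew | exact: matM_skew] | exact: nlsP | |].
- move=> z zs; have us := csmooth_field_of D z D_open zs; split=> [sol|[zu sol]].
    have zu : forall y, D y -> z y = state_of (field_of z) y.
      exact: hamiltonian_solution_state_of zs sol.
    split=> //; apply/(nlsP _ us).
    exact: hamiltonian_solution_near_eq D_open zu sol.
  apply: (hamiltonian_solution_near_eq _ _ _ D (state_of (field_of z))) => //.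
    by move=> y Dy; rewrite -zu.
  exact/(nlsP _ us).
- move=> z U W _ Us Ws _ solU solW y Dy.
  under eq_fun do rewrite omegaE.
  under [X in partial1 X]eq_fun do rewrite kformE.
  apply: (multisymplectic_conservation _ _ _ _ _ _ (matK_skew _) (matM_skew _)
    (hessian_hamiltonian_sym _ _ _ _ V_smooth) _ _ (solU y Dy) (solW y Dy)).
  - by move=> v; exact: smooth_derivable Us Dy.
  - by move=> v; exact: smooth_derivable Ws Dy.
Qed.
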